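(* If $H$ is a connected graph that contains two odd cycles, each of length at least $5$, that share at most one vertex, then $H$ is not contractible.
   Context: All graphs are finite and simple (no loops or multiple edges). Let $G$ and $H$ be graphs with $V(H)\subseteq V(G)$. An $H$-scheme in $G$ is a collection of paths $\{P_{uv}: uv\in E(H)\}$ such that (1) each $P_{uv}$ is a $u,v$-path in $G$ with $V(P_{uv})\cap V(H)=\{u,v\}$, and (2) whenever $e_1,\dots,e_k\in E(H)$ satisfy $V(P_{e_1})\cap\dots\cap V(P_{e_k})\neq\emptyset$, there is a vertex $u\in V(H)$ incident with each of $e_1,\dots,e_k$. $G$ has a rooted $H$-minor if there are pairwise vertex-disjoint connected subgraphs $C_v$ of $G$, one for each $v\in V(H)$, such that $v\in V(C_v)$ for all $v\in V(H)$ and for each edge $uv\in E(H)$ there is an edge of $G$ joining $C_u$ and $C_v$. A graph $H$ is contractible if every graph $G$ with $V(H)\subseteq V(G)$ that contains an $H$-scheme has a rooted $H$-minor. *)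

(* Defs.v *)
From mathcomp Require Import all_boot.

Set Implicit Arguments.
Unset Strict Implicit.
Unset Printing Implicit Defensive.

Record sgraph := SGraph {
  vertex :> finType;
  adj : rel vertex;
  adj_sym : symmetric adj;
  adj_irr : irreflexive adj
}.

Definition edges (G : sgraph) : {set {set G}} :=
  [set [set x; y] | x in [set: G], y in [set: G] & adj x y].

Record subgraph (G : sgraph) := Subgraph {
  sverts : {set G};
  sadj : rel G;
  sadj_sym : symmetric sadj;
  sadj_sub : forall x y, sadj x y -> [/\ adj x y, x \in sverts & y \in sverts]
}.

(* The graph with vertex set [A] and adjacency [e] is connected; [e] is meant
   to relate elements of [A] only, so that [connect e] does not leave [A]. *)
Definition connected_on (T : finType) (A : {set T}) (e : rel T) : Prop :=
  A != set0 /\ {in A &, forall x y, connect e x y}.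

Definition connected_graph (G : sgraph) : Prop :=
  connected_on [set: G] (@adj G).

Definition connected_subgraph (G : sgraph) (C : subgraph G) : Prop :=
  connected_on (sverts C) (sadj C).

(* [c] lists the vertices of a cycle in cyclic order; its length is [size c]. *)
Definition graph_cycle (G : sgraph) (c : seq G) : Prop :=
  (3 <= size c) && ucycleb (@adj G) c.

Definition path_from (G : sgraph) (x y : G) (p : seq G) : bool :=
  if p is z :: q then
    [&& z == x, last z q == y, path (@adj G) z q & uniq (z :: q)]
  else false.

(* A path is undirected: its vertices may be listed from either end. *)
Definition is_path (G : sgraph) (x y : G) (p : seq G) : bool :=
  path_from x y p || path_from y x p.

(* The inclusion of V(H) in V(G) is given by an injection [f : H -> G].
   [P] is only relevant on [edges H]; the edge uv is the set [[set u; v]].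
   In the second condition, [F] is the set of the edges e_1, ..., e_k (k >= 1). *)
Definition is_scheme (H G : sgraph) (f : H -> G) (P : {set H} -> seq G) : Prop :=
  (forall u v : H, adj u v ->
     is_path (f u) (f v) (P [set u; v]) /\
     [set x in P [set u; v]] :&: [set f w | w : H] = [set f u; f v]) /\
  (forall F : {set {set H}}, F \subset edges H -> F != set0 ->
     (exists x : G, forall e, e \in F -> x \in P e) ->
     exists u : H, forall e, e \in F -> u \in e).

Definition has_scheme (H G : sgraph) (f : H -> G) : Prop :=
  exists P : {set H} -> seq G, is_scheme f P.

Definition has_rooted_minor (H G : sgraph) (f : H -> G) : Prop :=
  exists C : H -> subgraph G,
    [/\ forall v, connected_subgraph (C v),
        forall u v, u != v -> [disjoint sverts (C u) & sverts (C v)],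
        forall v, f v \in sverts (C v)
      & forall u v, adj u v ->
          exists x y, [/\ x \in sverts (C u), y \in sverts (C v) & adj x y]].

Definition contractible (H : sgraph) : Prop :=
  forall (G : sgraph) (f : H -> G), injective f ->
    has_scheme f -> has_rooted_minor f.

(* Main.v *)
(* Choose in [H] a shortest path joining the two cycles (a single vertex if they
   meet) and let [D] be the dumbbell formed by the cycles and the path. Give every
   vertex [v] a shadow [x_v]; join the root [u] to [x_v], and [x_u] to [x_v], for
   every edge [uv] of [D], and join the roots of every other edge of [H]. The paths
   [u, x_v, x_u, v] form a scheme, since each shadow [x_v] is only used by edges at
   [v].  The direct edges between roots cannot help a bag to be connected, nor to
   touch another bag along [D].

   In the shadow graph of an odd cycle of length at least 5, a rooted minor puts
   each [x_w] in the bag of some [u <> w].  Indeed both neighbours of a root whose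
   bag has no shadow own at least two shadows; as there are as many shadows as
   roots, the set [S] of shadowless roots is invariant under rotation by two, hence,
   the length being odd, by one, while no two adjacent roots lie in [S].  So [S] is
   empty and every root owns exactly one shadow, that of a neighbour.

   So at its attachment vertex [w] each cycle of [D] either takes [x_w] away from
   the bag of [w], or forces that bag to reach [x_w] from outside the cycle.  This
   alternative is transmitted along the path, and its versions arriving at the same
   vertex from both sides are incompatible. *)
Require Import Defs.
From mathcomp Require Import all_boot.

Set Implicit Arguments.
Unset Strict Implicit.
Unset Printing Implicit Defensive.

(** * Adjacency along a cycle *)

Section CycleEdges.
Variables (V : finType) (c : seq V).

(** [next c] fixes every element outside [c]; the guard [u \in c] prevents loops there. *)
Definition cyc_edge : rel V :=
  fun u v => (u \in c) && ((v == next c u) || (u == next c v)).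

Lemma cyc_edge_mem u v : cyc_edge u v -> (u \in c) && (v \in c).
Proof.
move=> /andP[uc /orP[] /eqP E]; first by rewrite uc E mem_next.
by rewrite uc -(mem_next c) -E.
Qed.

Lemma cyc_edge_sym : symmetric cyc_edge.
Proof.
move=> u v; apply/idP/idP => uv; have /andP[uc vc] := cyc_edge_mem uv.
  by case/andP: uv => _ uv; rewrite /cyc_edge vc orbC.
by case/andP: uv => _ uv; rewrite /cyc_edge vc orbC.
Qed.

Hypotheses (Uc : uniq c) (size_c : 5 <= size c).

Lemma next_inj : injective (next c).
Proof. exact: can_inj (prev_next Uc). Qed.

Lemma iter_next_neq u k : u \in c -> 0 < k < size c -> iter k (next c) u != u.
Proof.
move=> uc /andP[k0 kc]; apply/eqP => E.
have := @findex_iter _ (next c) u k.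
rewrite (order_cycle (cycle_next Uc) Uc uc) E findex0 => /(_ kc) k_eq.
by rewrite -k_eq in k0.
Qed.

Lemma iter_next_size u : u \in c -> iter (size c) (next c) u = u.
Proof.
move=> uc; rewrite -(order_cycle (cycle_next Uc) Uc uc).
exact: (iter_order_cycle (cycle_next Uc)).
Qed.

Lemma cyc_edge_irr : irreflexive cyc_edge.
Proof.
move=> u; apply/negP => /andP[uc]; rewrite orbb => /eqP E.
have := iter_next_neq uc (_ : 0 < 1 < size c).
by rewrite /= -E eqxx => /(_ (leq_trans _ size_c)) => /(_ isT).
Qed.

(** Each edge is a step of [next c] in one direction. Coherent directions make three steps return to
    their start, against the length; any others identify two adjacent vertices. *)
Lemma cyc_edge_triangle_free u v w :
  cyc_edge u v -> cyc_edge v w -> cyc_edge u w -> False.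
Proof.
move=> uv vw uw; have /andP[uc vc] := cyc_edge_mem uv.
have wc : w \in c by case/andP: (cyc_edge_mem uw).
have no3 x : x \in c -> next c (next c (next c x)) <> x.
  move=> xc; apply/eqP; apply: (iter_next_neq (k := 3) xc).
  exact: (leq_trans (isT : 3 < 5) size_c).
have no1 x y : cyc_edge x y -> x = y -> False.
  by move=> xy E; rewrite E cyc_edge_irr in xy.
case/andP: (uv) => _ /orP[] /eqP E1; case/andP: (vw) => _ /orP[] /eqP E2;
  case/andP: (uw) => _ /orP[] /eqP E3.
- by apply: (no1 _ _ vw); rewrite E1 E3.
- by apply: (no3 u) => //; rewrite -E1 -E2.
- by apply: (no1 _ _ uw); apply: next_inj; rewrite -E1.
- by apply: (no1 _ _ uv); rewrite E3.
- by apply: (no1 _ _ uw); rewrite E1.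
- by apply: (no1 _ _ vw); apply: next_inj; rewrite -E1 -E3.
- by apply: (no3 u) => //; rewrite -E3 -E2.
- by apply: (no1 _ _ uv); rewrite E3 E2.
Qed.

End CycleEdges.

(** * Counting shadows on an odd cycle *)

Section OddCycle.
Variables (V : finType) (c : seq V) (C : V -> {set V * bool}).
Hypotheses (Uc : uniq c) (odd_c : odd (size c)) (size_c : 5 <= size c).
Hypothesis disjC : forall u v x, x \in C u -> x \in C v -> u = v.
Hypothesis rootC : forall v, (v, false) \in C v.
Hypothesis touchC : forall u v, u \in c -> v \in c -> (v, true) \in C u ->
  exists2 q, cyc_edge c u q & (q, true) \in C u.
Hypothesis joinC : forall u v, cyc_edge c u v ->
  exists p q b b', [/\ cyc_edge c p q, b || b', (p, b) \in C u & (q, b') \in C v].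

Let X u := [set v in c | (v, true) \in C u].
Let S := [set u in c | #|X u| == 0].
Let T := [set u in c | 2 <= #|X u|].

Lemma two_shadows u v w : v \in c -> w \in c -> v != w ->
  (v, true) \in C u -> (w, true) \in C u -> 2 <= #|X u|.
Proof.
move=> vc wc vw Cv Cw; rewrite (_ : 2 = #|[set v; w]|); last first.
  by rewrite cards2 vw.
by apply: subset_leq_card; apply/subsetP => x /set2P[] ->; rewrite inE ?vc ?wc.
Qed.

Lemma no_shadow u p b : u \in S -> p \in c -> (p, b) \in C u ->
  b = false /\ p = u.
Proof.
rewrite inE => /andP[uc]; rewrite cards_eq0 => /eqP Xu pc.
case: b => Cp; last by split=> //; apply: (disjC (rootC p) Cp).
by have : p \in X u; [rewrite inE pc | rewrite Xu inE].
Qed.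

(** On the cycle the bag of [u] has only its root, so it touches that of [v] at the shadow of a
    neighbour [q] of [u]. The bag of [v] then also owns the shadow of a neighbour [r] of [v], and
    [q <> r] for lack of triangles. *)
Lemma neighbor_no_shadow u v : u \in S -> cyc_edge c u v -> v \in T.
Proof.
move=> uS uv; have /andP[uc vc] := cyc_edge_mem uv.
have [p [q [b [b' [pq bb' Cp Cq]]]]] := joinC uv.
have /andP[pc qc] := cyc_edge_mem pq.
have [b0 pu] := no_shadow uS pc Cp.
rewrite {}b0 /= in bb'; rewrite {}bb' in Cq; rewrite {}pu in pq.
have [r vr Cr] := touchC vc qc Cq.
have rc : r \in c by case/andP: (cyc_edge_mem vr).
rewrite inE vc /=; apply: (two_shadows qc rc) => //.
apply/eqP => qr; rewrite -qr in vr.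
exact: (cyc_edge_triangle_free Uc size_c uv vr pq).
Qed.

Let K := [set u in c].

Lemma cardK : #|K| = size c.
Proof. by rewrite cardsE; apply/card_uniqP. Qed.

Lemma sum_shadowsE :
  \sum_(u in K) #|X u| = \sum_(v in K) #|[set u in c | (v, true) \in C u]|.
Proof.
under eq_bigr => u _ do
  (rewrite -sum1_card (eq_bigl (fun v => (v \in K) && ((v, true) \in C u)));
   last by move=> v; rewrite !inE).
under [RHS]eq_bigr => v _ do
  (rewrite -sum1_card (eq_bigl (fun u => (u \in K) && ((v, true) \in C u)));
   last by move=> u; rewrite !inE).
rewrite (exchange_big_dep (mem K)) //= => [|u v _ /andP[] //].
by apply: eq_bigr => v vK; apply: eq_bigl => u; rewrite vK.
Qed.

Lemma owners_le1 v : #|[set u in c | (v, true) \in C u]| <= 1.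
Proof.
apply/card_le1_eqP => u u'; rewrite !inE => /andP[_ Cu] /andP[_ Cu'].
exact: disjC Cu' Cu.
Qed.

(** Sum of the pointwise bounds [1 + (u \in T) <= #|X u| + (u \in S)]. *)
Lemma sum_shadows_ge : size c + #|T| <= \sum_(u in K) #|X u| + #|S|.
Proof.
have cardE (A : {set V}) : A \subset K -> #|A| = \sum_(u in K) (u \in A).
  move=> /subsetP AK; rewrite -sum1_card big_mkcond [RHS]big_mkcond /=.
  apply: eq_bigr => u _; have := AK u.
  by case: (u \in A) => [->|] //; case: (u \in K).
rewrite -cardK -sum1_card (cardE T) 1?(cardE S); first last.
- by apply/subsetP => u; rewrite !inE => /andP[].
- by apply/subsetP => u; rewrite !inE => /andP[].
rewrite -!big_split /=; apply: leq_sum => u; rewrite !inE => -> /=.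
by case: #|X u| => [|[|k]].
Qed.

Lemma sum_shadows_le : \sum_(u in K) #|X u| <= size c.
Proof.
rewrite sum_shadowsE -cardK -sum1_card; apply: leq_sum => v _.
exact: owners_le1.
Qed.

Lemma cyc_edge_next u : u \in c -> cyc_edge c u (next c u).
Proof. by move=> uc; rewrite /cyc_edge uc eqxx. Qed.

Lemma cyc_edge_prev u : u \in c -> cyc_edge c u (prev c u).
Proof. by move=> uc; rewrite /cyc_edge uc next_prev // eqxx orbT. Qed.

Lemma S_empty : S = set0.
Proof.
have leTS : #|T| <= #|S|.
  rewrite -(leq_add2l (size c)); apply: leq_trans sum_shadows_ge _.
  by rewrite leq_add2r sum_shadows_le.
(* Such an [f] maps [S] into [T], and onto it since [#|T| <= #|S|]. *)
have imT (f : V -> V) : injective f -> (forall u, u \in c -> cyc_edge c u (f u)) ->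
    f @: S = T.
  move=> finj fE; apply/eqP; rewrite eqEcard card_imset // leTS andbT.
  apply/subsetP => _ /imsetP[u uS ->]; apply: (neighbor_no_shadow uS).
  by apply: fE; move: uS; rewrite inE => /andP[].
have nextS := imT _ (next_inj Uc) cyc_edge_next.
have prevS := imT _ (can_inj (next_prev Uc)) cyc_edge_prev.
apply/setP => u; rewrite [RHS]inE; apply/negP => uS.
have uc : u \in c by move: uS; rewrite inE => /andP[].
(* [next c x] lies in [T], so it is [prev c y] for some [y] in [S], and this [y] is
   [next c (next c x)]. *)
have step x : x \in S -> next c (next c x) \in S.
  move=> xS; have : next c x \in T by rewrite -nextS imset_f.
  by rewrite -prevS => /imsetP[y yS ->]; rewrite next_prev.
have iter_evenS k : iter k.*2 (next c) u \in S.
  by elim: k => [|k IHk] //; rewrite doubleS; apply: step.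
have : next c u \in S.
  (* [size c + 1] is even, and that many steps amount to a single one. *)
  have := iter_evenS (size c).+1./2.
  rewrite (_ : _.*2 = (size c).+1); first by rewrite iterS iter_next_size.
  by rewrite -[RHS]odd_double_half /= odd_c.
have : next c u \in T by rewrite -nextS imset_f.
by rewrite !inE => /andP[_] /[swap] /andP[_ /eqP ->].
Qed.

(** With [S] empty, the count leaves [T] empty and no shadow without an owner on the cycle. If [w]
    owned its own shadow, [touchC] would give it a second one and put it in [T]. *)
Lemma odd_cycle_shadow_owner w : w \in c ->
  exists2 u, (u \in c) && (u != w) & (w, true) \in C u.
Proof.
move=> wc; have := sum_shadows_ge; rewrite S_empty cards0 addn0 => ge.
have T0 : T = set0.
  apply/eqP; rewrite -cards_eq0 -leqn0 -(leq_add2l (size c)) addn0.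
  exact: leq_trans ge sum_shadows_le.
have [u] : exists u, u \in [set u in c | (w, true) \in C u].
  apply/set0Pn; apply/negP => /eqP E0.
  move: ge; rewrite T0 cards0 addn0 leqNgt => /negP; apply.
  rewrite sum_shadowsE -cardK -sum1_card.
  have wK : w \in K by rewrite inE.
  rewrite (bigD1 w) //= E0 cards0 [X in _ < X](bigD1 w) //= add0n add1n ltnS.
  by apply: leq_sum => v _; apply: owners_le1.
rewrite inE => /andP[uc Cu]; exists u => //; rewrite uc /=.
apply/eqP => uw; rewrite {}uw {u uc} in Cu.
have [q wq Cq] := touchC wc wc Cu.
have qc : q \in c by case/andP: (cyc_edge_mem wq).
have : w \in T.
  rewrite inE wc; apply: (two_shadows wc qc) => //; apply/eqP => E.
  by rewrite -E (cyc_edge_irr Uc size_c) in wq.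
by rewrite T0 inE.
Qed.

End OddCycle.

(** * Blocked shadows and their transmission *)

Section Bags.
Variables (V : finType) (e : rel V) (C : V -> {set V * bool}).
Hypotheses (e_sym : symmetric e) (e_irr : irreflexive e).

(* [(v, false)] is the root [v] and [(v, true)] its shadow. *)
Definition shadow_adj : rel (V * bool) := fun x y => e x.1 y.1 && (x.2 || y.2).

Hypothesis rootC : forall v, (v, false) \in C v.
Hypothesis disjC : forall u v x, x \in C u -> x \in C v -> u = v.
(** Connectivity of each bag, put as an induction principle. *)
Hypothesis connC : forall v (A : pred (V * bool)) x, x \in C v -> A x ->
  (forall y z, y \in C v -> z \in C v -> A y -> shadow_adj y z -> A z) ->
  forall y, y \in C v -> A y.
Hypothesis adjC : forall u v, e u v ->
  exists x y, [/\ x \in C u, y \in C v & shadow_adj x y].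

Lemma root_in u v : (u, false) \in C v -> u = v.
Proof. exact: disjC (rootC u). Qed.

(** Two roots are never related by [shadow_adj], so a bag can leave its root only through the shadow
    of a neighbour. *)
Lemma root_exit v u : (u, true) \in C v ->
  exists2 q, e v q & (q, true) \in C v.
Proof.
move=> Cu.
case: (pickP [pred q | e v q && ((q, true) \in C v)]) => [q /andP[]|none].
  by exists q.
suff /eqP : (u, true) == (v, false) by [].
apply: (@connC v (pred1 (v, false)) _ (rootC v) _ _ _ Cu) => //= y [q b] _ Cz /eqP ->.
case/andP=> /= vq b1; rewrite b1 in Cz.
by have := none q; rewrite /= vq Cz.
Qed.

(* On the side [K], where [w] is the only exit: either the shadow of [w] is taken
   by another bag of that side, or it is in the bag of [w], which reaches it from
   outside of [K]. *)
Definition shadow_blocked (K : {set V}) (w : V) : Prop :=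
  (exists2 u, (u \in K) && (u != w) & (w, true) \in C u) \/
  ((w, true) \in C w /\ forall v, v \in K -> e w v -> (v, true) \notin C w).

Section Cycle.
Variables (c : seq V) (w : V).
Hypotheses (Uc : uniq c) (odd_c : odd (size c)) (size_c : 5 <= size c).
Hypothesis wc : w \in c.
Hypothesis cyc_e : forall u v, cyc_edge c u v -> e u v.
Hypothesis e_cyc : forall u v, u \in c -> v \in c -> e u v -> cyc_edge c u v.
Hypothesis exit_w : forall u v, u \in c -> u != w -> e u v -> v \in c.

(** If both alternatives fail, the bags satisfy the hypotheses of [odd_cycle_shadow_owner], which
    yields the excluded owner. *)
Lemma odd_cycle_shadow_blocked : shadow_blocked [set x in c] w.
Proof.
case: (pickP [pred u | [&& u \in c, u != w & (w, true) \in C u]]) => [u|no_owner].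
  by case/and3P=> uc uw Cu; left; exists u; rewrite // inE uc.
have not_owner u : u \in c -> u != w -> (w, true) \notin C u.
  by move=> uc uw; apply/negP => Cu; have := no_owner u; rewrite /= uc uw Cu.
case: (boolP (((w, true) \in C w) &&
    [forall v in c, e w v ==> ((v, true) \notin C w)])) => [/andP[Cw all_w]|open].
  right; split=> // v; rewrite inE => vc; apply/implyP.
  exact: (forall_inP all_w).
exfalso.
(* The way out passes through the root or the shadow of [w], and the bag of [u] has neither. *)
have inside u x : u \in c -> u != w -> x \in C u -> (x.1 \in c) && (x.1 != w).
  move=> uc uw; apply: (connC (A := fun x => (x.1 \in c) && (x.1 != w)) (rootC u)).
    by rewrite /= uc.
  move=> y [v b] _ Cv /andP[yc yw] /andP[/= yv _]; rewrite (exit_w yc yw yv) /=.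
  apply/eqP => vw; rewrite {}vw in Cv; case: b Cv => Cv.
    by have := not_owner u uc uw; rewrite Cv.
  by rewrite (root_in Cv) eqxx in uw.
have touch u v : u \in c -> v \in c -> (v, true) \in C u ->
    exists2 q, cyc_edge c u q & (q, true) \in C u.
  move=> uc vc Cv; have [uw|uw] := eqVneq u w; last first.
    have [q uq Cq] := root_exit Cv.
    by exists q => //; apply: e_cyc => //; apply: exit_w uc uw uq.
  rewrite {}uw {u uc} in Cv *.
  case: (pickP [pred q | cyc_edge c w q && ((q, true) \in C w)]) => [q /andP[]|none].
    by exists q.
  have [Cw|Cw] := boolP ((w, true) \in C w).
    move: open; rewrite Cw /= negb_forall_in => /exists_inP[q qc].
    rewrite negb_imply negbK => /andP[wq Cq].
    by have := none q; rewrite /= Cq e_cyc.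
  (* From [(v, true)] the bag of [w] could never leave the shadows of the cycle: it lacks
     [(w, true)], and [none] denies it the shadows next to its root. Yet it contains that root. *)
  suff : (w \in c) && false by rewrite andbF.
  apply: (@connC w (fun x => (x.1 \in c) && x.2) _ Cv _ _ _ (rootC w)).
    by rewrite /= vc.
  move=> [x1 x2] [z1 z2] /= Cx Cz /andP[xc]; case: x2 Cx => // Cx _ /andP[/= xz _].
  have xw : x1 != w by apply/eqP => xw; move: Cw; rewrite -{1}xw Cx.
  rewrite (exit_w xc xw xz) /=; case: z2 Cz => // /root_in zw.
  have := none x1; rewrite /= Cx andbT e_cyc //.
  by rewrite e_sym -zw.
have join u v : cyc_edge c u v -> exists p q b b',
    [/\ cyc_edge c p q, b || b', (p, b) \in C u & (q, b') \in C v].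
  move=> uv; have [[p b] [[q b'] [Cp Cq /andP[/= pq bb']]]] := adjC (cyc_e uv).
  exists p, q, b, b'; split=> //; have /andP[uc vc] := cyc_edge_mem uv.
  (* One end of the edge differs from [w]; its bag stays in [c] away from [w], which keeps the
     contact edge on the cycle. *)
  have [uw|uw] := eqVneq u w; last first.
    have /andP[/= pc pw] := inside u _ uc uw Cp.
    by apply: e_cyc => //; apply: exit_w pc pw pq.
  have vw : v != w.
    by apply/eqP => vw; move: uv; rewrite uw vw cyc_edge_irr.
  have /andP[/= qc qw] := inside v _ vc vw Cq.
  rewrite e_sym in pq; rewrite cyc_edge_sym.
  by apply: e_cyc => //; apply: exit_w qc qw pq.
have [u /andP[uc uw] Cu] :=
  odd_cycle_shadow_owner Uc odd_c size_c disjC rootC touch join wc.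
by have := not_owner u uc uw; rewrite Cu.
Qed.

End Cycle.

(** The edge [ww'] is the only exit of [K], so everything depends on who owns the shadows of its two
    ends. *)
Lemma shadow_blocked_step (K : {set V}) (w w' : V) :
  w \in K -> w' \notin K -> e w w' ->
  (forall u v, u \in K -> v \notin K -> e u v -> u = w /\ v = w') ->
  shadow_blocked K w -> shadow_blocked (w' |: K) w'.
Proof.
move=> wK w'K ww' exitK blocked.
have w_neq : w != w' by apply: contraNneq w'K => <-.
suff [Cw|[Cw' Cw]] : (w', true) \in C w \/
    ((w', true) \in C w' /\ (w, true) \notin C w').
- by left; exists w; rewrite // !inE wK orbT.
- right; split=> // v; rewrite !inE => /orP[/eqP ->|vK] w'v.
    by rewrite e_irr in w'v.
  by have [-> _] := exitK v w' vK w'K (etrans (e_sym _ _) w'v).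
(* In the second alternative the bag of [w] exits its root outside [K], hence at the shadow of
   [w']. *)
case: blocked => [[u /andP[uK uw] Cu]|[Cw noK]]; last first.
  have [v wv Cv] := root_exit Cw; left.
  have vK : v \notin K by apply/negP => /noK /(_ wv); rewrite Cv.
  by have [_ <-] := exitK w v wK vK wv.
have Cw : (w, true) \notin C w.
  by apply: contra uw => Cw; rewrite (disjC Cu Cw).
have Cw' : (w, true) \notin C w'.
  by apply: contra w'K => Cw'; rewrite -(disjC Cu Cw').
have [Dw|Dw] := boolP ((w', true) \in C w); first by left.
have [Dw'|Dw'] := boolP ((w', true) \in C w'); first by right.
(* Neither bag can now cross the exit, so they touch along [ww'] itself; this needs [(w, true)] in
   the bag of [w] or [(w', true)] in that of [w']. *)
exfalso.
have inK x : x \in C w -> x.1 \in K.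
  apply: (connC (A := fun x => x.1 \in K) (rootC w)) => // [[u1 b1]] [v b] /= _ Cv yK.
  case/andP=> /= yv _; apply: contraT => vK; have [_ vw'] := exitK _ _ yK vK yv.
  rewrite vw' in Cv; case: b Cv => Cv; first by rewrite Cv in Dw.
  by rewrite (root_in Cv) eqxx in w_neq.
have outK x : x \in C w' -> x.1 \notin K.
  apply: (connC (A := fun x => x.1 \notin K) (rootC w')) => // [[u1 b1]] [v b] /= _ Cv yK.
  case/andP=> /= yv _; apply/negP => vK; rewrite e_sym in yv.
  have [vw _] := exitK _ _ vK yK yv.
  rewrite vw in Cv; case: b Cv => Cv; first by rewrite Cv in Cw'.
  by rewrite (root_in Cv) eqxx in w_neq.
have [[p b] [[q b'] [Cp Cq /andP[/= pq bb']]]] := adjC ww'.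
have [/= pw qw'] := exitK _ _ (inK _ Cp) (outK _ Cq) pq.
rewrite pw in Cp; rewrite qw' in Cq.
case: b bb' Cp => /= [_|b'1] Cp; first by rewrite Cp in Cw.
by rewrite b'1 in Cq; rewrite Cq in Dw'.
Qed.

(** The shadow of [w] has one owner: it cannot differ from [w] on both sides, nor on just one. If it
    is [w] on both, the root of [w] has no exit left. *)
Lemma shadow_blocked_both (K K' : {set V}) (w : V) :
  (forall v, v \in K -> v \in K' -> v = w) ->
  (forall v, e w v -> (v \in K) || (v \in K')) ->
  shadow_blocked K w -> shadow_blocked K' w -> False.
Proof.
move=> KK' nbrs [[u /andP[uK uw] Cu]|[Cw noK]] [[u' /andP[uK' uw'] Cu']|[Cw' noK']].
- by move: uw; rewrite (KK' u) ?eqxx // (disjC Cu Cu').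
- by rewrite (disjC Cu Cw') eqxx in uw.
- by rewrite (disjC Cu' Cw) eqxx in uw'.
have [v wv Cv] := root_exit Cw.
by case/orP: (nbrs v wv) => [/noK|/noK'] /(_ wv); rewrite Cv.
Qed.

End Bags.

(** * The dumbbell admits no bags *)

Section Dumbbell.
Variables (V : finType) (c1 c2 : seq V) (x : V) (p : seq V).

(** A step forward along the path. An absent [v] has index [size (x :: p)], one more than the last
    vertex, which [v \in x :: p] rules out. *)
Definition link_edge : rel V :=
  fun u v => (v \in x :: p) && (index v (x :: p) == (index u (x :: p)).+1).

Definition dumbbell : rel V :=
  fun u v => [|| cyc_edge c1 u v, cyc_edge c2 u v, link_edge u v | link_edge v u].

Lemma link_edge_mem u v : link_edge u v -> (u \in x :: p) && (v \in x :: p).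
Proof.
case/andP=> vp /eqP E; rewrite vp andbT -index_mem.
by apply: (ltn_trans (ltnSn _)); rewrite -E index_mem.
Qed.

Lemma link_edge_neq u v : link_edge u v -> u != v.
Proof.
by case/andP=> _ uv; apply: contraTneq uv => ->; rewrite neq_ltn ltnSn.
Qed.

Lemma dumbbell_sym : symmetric dumbbell.
Proof.
move=> u v; rewrite /dumbbell (cyc_edge_sym c1) (cyc_edge_sym c2).
by rewrite [link_edge u v || _]orbC.
Qed.

Hypotheses (U1 : uniq c1) (odd1 : odd (size c1)) (size1 : 5 <= size c1).
Hypotheses (U2 : uniq c2) (odd2 : odd (size c2)) (size2 : 5 <= size c2).
Hypotheses (xc1 : x \in c1) (lastc2 : last x p \in c2) (Up : uniq (x :: p)).
Hypothesis link1 : forall z, z \in x :: p -> z \in c1 -> z = x.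
Hypothesis link2 : forall z, z \in x :: p -> z \in c2 -> z = last x p.
Hypothesis share : forall z, z \in c1 -> z \in c2 -> z = x /\ p = [::].

Lemma dumbbell_irr : irreflexive dumbbell.
Proof.
move=> u; rewrite /dumbbell !cyc_edge_irr //= orbb; apply/negP => uu.
by have := link_edge_neq uu; rewrite eqxx.
Qed.

Lemma dumbbellP u v : dumbbell u v ->
  [\/ cyc_edge c1 u v, cyc_edge c2 u v |
      [/\ u \in x :: p, v \in x :: p & u != v]].
Proof.
case/or4P => [uv|uv|uv|uv]; [exact: Or31|exact: Or32|apply: Or33..].
  by have /andP[] := link_edge_mem uv; split=> //; apply: link_edge_neq.
have /andP[] := link_edge_mem uv; split=> //.
by rewrite eq_sym; apply: link_edge_neq.
Qed.

Section NoBags.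
Variable C : V -> {set V * bool}.
Hypothesis rootC : forall v, (v, false) \in C v.
Hypothesis disjC : forall u v y, y \in C u -> y \in C v -> u = v.
Hypothesis connC : forall v (A : pred (V * bool)) y, y \in C v -> A y ->
  (forall y z, y \in C v -> z \in C v -> A y -> shadow_adj dumbbell y z -> A z) ->
  forall y, y \in C v -> A y.
Hypothesis adjC : forall u v, dumbbell u v ->
  exists y z, [/\ y \in C u, z \in C v & shadow_adj dumbbell y z].

Lemma left_cycle_blocked : shadow_blocked dumbbell C [set z in c1] x.
Proof.
apply: (odd_cycle_shadow_blocked dumbbell_sym rootC disjC connC adjC) => //.
- by move=> u v uv; rewrite /dumbbell uv.
- move=> u v uc vc /dumbbellP[//|uv|[up vp uv]].
    have /andP[uc2 vc2] := cyc_edge_mem uv; move: uv.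
    rewrite (share uc uc2).1 (share vc vc2).1.
    by rewrite cyc_edge_irr.
  by rewrite (link1 up uc) (link1 vp vc) eqxx in uv.
- move=> u v uc ux /dumbbellP[/cyc_edge_mem/andP[]//|/cyc_edge_mem/andP[uc2 _]|[up _ _]].
    by rewrite (share uc uc2).1 eqxx in ux.
  by rewrite (link1 up uc) eqxx in ux.
Qed.

Lemma share_last z : z \in c1 -> z \in c2 -> z = last x p.
Proof. by move=> z1 z2; have [-> ->] := share z1 z2. Qed.

Lemma right_cycle_blocked : shadow_blocked dumbbell C [set z in c2] (last x p).
Proof.
apply: (odd_cycle_shadow_blocked dumbbell_sym rootC disjC connC adjC) => //.
- by move=> u v uv; rewrite /dumbbell uv orbT.
- move=> u v uc vc /dumbbellP[uv|//|[up vp uv]].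
    have /andP[uc1 vc1] := cyc_edge_mem uv; move: uv.
    rewrite (share uc1 uc).1 (share vc1 vc).1.
    by rewrite cyc_edge_irr.
  by rewrite (link2 up uc) (link2 vp vc) eqxx in uv.
- move=> u v uc ux /dumbbellP[/cyc_edge_mem/andP[uc1 _]|/cyc_edge_mem/andP[]//|[up _ _]].
    by rewrite (share_last uc1 uc) eqxx in ux.
  by rewrite (link2 up uc) eqxx in ux.
Qed.

(** Induction along the path from the first cycle, adding one path vertex at a time; vertices off
    the path have index above [size p]. *)
Lemma link_blocked i : i <= size p -> shadow_blocked dumbbell C
  [set z | (z \in c1) || (index z (x :: p) <= i)] (nth x (x :: p) i).
Proof.
elim: i => [_|i IHi ip].
  rewrite (_ : [set z | _] = [set z in c1]); first exact: left_cycle_blocked.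
  apply/setP => z; rewrite !inE /=.
  by case: eqVneq => [<-|_]; rewrite ?xc1 ?orbF.
pose K := [set z | (z \in c1) || (index z (x :: p) <= i)].
have idx j : j <= size p -> index (nth x (x :: p) j) (x :: p) = j.
  by move=> jp; rewrite index_uniq.
have small u j : j <= size p -> index u (x :: p) <= j -> u \in x :: p.
  by move=> jp uj; rewrite -index_mem (leq_ltn_trans uj).
have idx1 u : u \in x :: p -> u \in c1 -> index u (x :: p) = 0.
  by move=> up uc; rewrite (link1 up uc) /= eqxx.
rewrite (_ : [set z | _] = nth x (x :: p) i.+1 |: K); last first.
  apply/setP => z; rewrite !inE leq_eqVlt ltnS orbCA; congr (_ || _).
  apply/eqP/eqP => [E|->]; last exact: idx.
  by rewrite -E nth_index // (small _ i.+1) // E.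
apply: (shadow_blocked_step dumbbell_sym dumbbell_irr rootC disjC connC adjC)
  (IHi (ltnW ip)).
- by rewrite inE idx ?leqnn ?orbT // ltnW.
- rewrite inE idx // ltnn orbF; apply/negP => wc.
  have := idx1 _ _ wc; rewrite idx // => H.
  by have := H (small _ _ ip (eq_leq (idx _ ip))).
- apply/or4P; apply: Or43; rewrite /link_edge mem_nth //.
  by rewrite (idx _ ip) (idx _ (ltnW ip)) eqxx.
(* Only the forward path edge at position [i] leaves [K]: the second cycle is not yet reached, as
   [i < size p]. *)
move=> u v; rewrite !inE negb_or -ltnNge => uK /andP[vc1 iv].
case/or4P => [/cyc_edge_mem/andP[_ vc]|/cyc_edge_mem/andP[uc _]|uv|vu].
- by rewrite vc in vc1.
- case/orP: uK => [uc1|ui].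
    by have [_ p0] := share uc1 uc; rewrite p0 in ip.
  have ul := link2 (small _ _ (ltnW ip) ui) uc.
  move: ui; rewrite ul (last_nth x) idx //.
  by rewrite leqNgt ip.
- have /andP[up vp] := link_edge_mem uv; case/andP: uv => _ /eqP uv.
  have ui : index u (x :: p) <= i by case/orP: uK => // /(idx1 _ up) ->.
  have ui' : index u (x :: p) = i by apply/eqP; rewrite eqn_leq ui -ltnS -uv.
  split; first by rewrite -[LHS](nth_index x up) ui'.
  by rewrite -[LHS](nth_index x vp) uv ui'.
- have /andP[vp up] := link_edge_mem vu; case/andP: vu => _ /eqP vu.
  have := iv; rewrite -ltnS -vu; case/orP: uK => [/(idx1 _ up) -> //|ui].
  by rewrite ltnNge (leq_trans ui (leqnSn i)).
Qed.

Lemma dumbbell_no_bags : False.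
Proof.
(* At [i = size p] the set consists of [c1] and the whole path, and meets [c2] only in
   [last x p]. *)
have := link_blocked (leqnn _); rewrite -(last_nth x) => blocked.
apply: (shadow_blocked_both rootC disjC connC) blocked right_cycle_blocked.
  move=> z; rewrite !inE => /orP[z1 z2|zp z2]; first exact: share_last.
  by apply: link2 => //; rewrite -index_mem.
move=> z /dumbbellP[/cyc_edge_mem/andP[_ zc]|/cyc_edge_mem/andP[_ zc]|[_ zp _]].
- by rewrite !inE zc.
- by rewrite !inE zc orbT.
- by rewrite !inE -ltnS index_mem zp orbT.
Qed.

End NoBags.
End Dumbbell.

(** * A path meeting two vertex sets only at its ends *)

Lemma shortest_link (V : finType) (e : rel V) (A B : pred V) x p :
  A x -> B (last x p) -> path e x p -> uniq (x :: p) ->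
  exists x' p', [/\ A x', B (last x' p'), path e x' p', uniq (x' :: p') &
    forall z, z \in x' :: p' -> (A z -> z = x') /\ (B z -> z = last x' p')].
Proof.
have [n] := ubnP (size p); elim: n x p => // n IHn x p; rewrite ltnS => pn.
move=> Ax Bp ep Up.
(* A later vertex of [A] lets the path start there; below, an earlier vertex of [B] lets it stop
   there. *)
have [/hasP[z zp Az]|noA] := boolP (has A p).
  case/splitPr: zp pn Bp ep Up => p1 p2; rewrite size_cat addnS => pn.
  rewrite last_cat cat_path -cat_cons cat_uniq /= => Bp /and3P[_ _ ep] /and3P[_ _ Up].
  by apply: (IHn z p2) => //; apply: leq_trans pn; rewrite ltnS leq_addl.
have [/hasP[z zp /andP[Bz zl]]|noB] := boolP (has (fun z => B z && (z != last x p)) (x :: p)).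
  case/splitPl: zp pn zl Bp ep Up Bz => p1 p2 p1z; case: p2 => [|y p2].
    by rewrite cats0 p1z eqxx.
  rewrite size_cat addnS cat_path -cat_cons cat_uniq -p1z => pn _ _.
  case/andP=> ep _ /andP[Up _] Bz.
  by apply: (IHn x p1) => //; apply: leq_trans pn; rewrite ltnS leq_addr.
exists x, p; split=> // z zp; split=> [Az|Bz].
  move: zp; rewrite inE => /orP[/eqP //|zp].
  by case/hasP: noA; exists z.
apply/eqP; apply: contraNT noB => zl; apply/hasP; exists z => //.
by rewrite Bz.
Qed.

(** * The shadow graph, its scheme and its minors *)

Section Shadow.
Variables (H : sgraph) (e : rel H).
Hypotheses (e_sym : symmetric e) (e_adj : forall u v, e u v -> adj u v).

Definition shadow_graph_adj : rel (H * bool) := fun x y =>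
  shadow_adj e x y || [&& adj x.1 y.1, ~~ e x.1 y.1, ~~ x.2 & ~~ y.2].

Lemma shadow_graph_sym : symmetric shadow_graph_adj.
Proof.
move=> x y; rewrite /shadow_graph_adj /shadow_adj e_sym adj_sym (orbC x.2).
by rewrite (andbC (~~ x.2)).
Qed.

Lemma shadow_graph_irr : irreflexive shadow_graph_adj.
Proof.
move=> x; rewrite /shadow_graph_adj /shadow_adj adj_irr orbF.
by apply/negP => /andP[/e_adj]; rewrite adj_irr.
Qed.

Definition shadow_graph : sgraph := SGraph shadow_graph_sym shadow_graph_irr.

Definition shadow_root (v : H) : shadow_graph := (v, false).

Definition route (u v : H) : seq shadow_graph :=
  if e u v then [:: (u, false); (v, true); (u, true); (v, false)]
  else [:: (u, false); (v, false)].

(** A scheme is indexed by unordered edges, so [pick] chooses an arbitrary orientation, harmless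
    since [is_path] accepts both. *)
Definition edge_route (E : {set H}) : seq shadow_graph :=
  if [pick uv : H * H | E == [set uv.1; uv.2]] is Some uv
  then route uv.1 uv.2 else [::].

Lemma edge_routeE u v :
  edge_route [set u; v] = route u v \/ edge_route [set u; v] = route v u.
Proof.
rewrite /edge_route; case: pickP => [[u' v'] /= /eqP E|/(_ (u, v))]; last first.
  by rewrite eqxx.
have u'uv : u' \in [set u; v] by rewrite E set21.
have v'uv : v' \in [set u; v] by rewrite E set22.
have uu'v' : u \in [set u'; v'] by rewrite -E set21.
have vu'v' : v \in [set u'; v'] by rewrite -E set22.
move: u'uv v'uv uu'v' vu'v'; rewrite !inE {E}.
case/orP=> /eqP -> /orP[] /eqP ->; rewrite ?orbb; [|by left|by right|].
  by move=> _ /eqP ->; left.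
by move=> /eqP -> _; left.
Qed.

Lemma route_path u v : adj u v -> path_from (shadow_root u) (shadow_root v) (route u v).
Proof.
move=> uv; have uv_neq : u == v = false.
  by apply: contraTF uv => /eqP ->; rewrite adj_irr.
rewrite /route; case: (boolP (e u v)) => euv /=; rewrite !eqxx /= !inE !xpair_eqE.
  rewrite /shadow_graph_adj /shadow_adj /= euv (e_sym v u) euv /=.
  by rewrite (eq_sym v u) uv_neq /= !andbF.
by rewrite /shadow_graph_adj /shadow_adj /= uv euv !andbF uv_neq.
Qed.

Lemma route_roots u v :
  [set x in route u v] :&: [set shadow_root w | w : H] =
  [set shadow_root u; shadow_root v].
Proof.
apply/setP=> [[w b]]; rewrite !inE; case: b.
  rewrite (_ : _ \in [set shadow_root w | w : H] = false).
    by rewrite andbF !xpair_eqE !andbF.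
  by apply/negP => /imsetP[z _].
rewrite (_ : _ \in [set shadow_root w | w : H]) ?andbT; last exact: imset_f.
by rewrite /route; case: ifP; rewrite !inE !xpair_eqE ?andbF.
Qed.

Lemma mem_route u v x : x \in route u v -> x.1 \in [set u; v].
Proof.
case: x => w b; rewrite /route; case: ifP => _; rewrite !inE !xpair_eqE /=.
  by case/or4P=> /andP[-> _] //; rewrite orbT.
by case/orP=> /andP[-> _] //; rewrite orbT.
Qed.

Lemma shadow_graph_scheme : has_scheme shadow_root.
Proof.
exists edge_route; split=> [u v uv|F FE F0 [x xF]].
  have vu : adj v u by rewrite adj_sym.
  case: (edge_routeE u v) => ->; split; rewrite ?route_roots //.
  - by rewrite /is_path route_path.
  - by rewrite /is_path route_path ?orbT.
  - by rewrite setUC.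
(* A route only visits roots and shadows of the ends of its edge, so [x.1] is an end of each edge in
   [F]. *)
exists x.1 => E EF; have := subsetP FE E EF => /imset2P[u v _ _ Euv].
have := xF E EF; rewrite {E EF}Euv.
by case: (edge_routeE u v) => -> /mem_route //; rewrite setUC.
Qed.

(** A bag holds no root but its own. A direct edge between roots thus never lies inside a bag, and
    joins the bags of [u] and [v] only if it is [uv] itself, which [e u v] forbids. *)
Lemma shadow_graph_bags : has_rooted_minor shadow_root ->
  exists C : H -> {set H * bool}, [/\ forall v, (v, false) \in C v,
    forall u v x, x \in C u -> x \in C v -> u = v,
    forall v (A : pred (H * bool)) x, x \in C v -> A x ->
      (forall y z, y \in C v -> z \in C v -> A y -> shadow_adj e y z -> A z) ->
      forall y, y \in C v -> A y &
    forall u v, e u v ->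
      exists x y, [/\ x \in C u, y \in C v & shadow_adj e x y]].
Proof.
case=> C [conn disj root adjC]; exists (fun v => sverts (C v)).
have disjP u v x : x \in sverts (C u) -> x \in sverts (C v) -> u = v.
  move=> xu xv; apply/eqP; apply: contraT => /disj /disjointFr /(_ xu).
  by rewrite xv.
split=> // [v A x xv Ax step y yv|u v uv].
  have /connectP[q] := (conn v).2 x y xv yv.
  elim: q x xv Ax => [|z q IHq] x xv Ax /=; first by move=> _ ->.
  case/andP=> xz qz; have [/= xz_adj _ zv] := sadj_sub xz.
  apply: IHq qz => //; apply: (step x) => //.
  case/orP: xz_adj => // /and4P[xz_adj _ x2 z2].
  case: x z x2 z2 xv zv xz_adj {Ax xz} => [x []] [z []] //= _ _ xv zv.
  by rewrite (disjP _ _ _ (root x) xv) (disjP _ _ _ (root z) zv) adj_irr.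
have [x [y [xu yv xy]]] := adjC u v (e_adj uv); exists x, y; split=> //.
case/orP: xy => // /and4P[_ nxy x2 y2]; case: x y x2 y2 xu yv nxy => [x []] [y []] //= _ _ xu yv.
by rewrite (disjP _ _ _ (root x) xu) (disjP _ _ _ (root y) yv) uv.
Qed.

End Shadow.

(** * Finding the dumbbell in the given graph *)

Lemma cyc_edge_adj (H : sgraph) (c : seq H) u v :
  ucycleb (@adj H) c -> cyc_edge c u v -> adj u v.
Proof.
move=> /andP[cyc _] uv; have /andP[uc vc] := cyc_edge_mem uv.
case/andP: uv => _ /orP[] /eqP ->; first exact: next_cycle.
by rewrite adj_sym; apply: next_cycle.
Qed.

Lemma link_edge_adj (H : sgraph) (x : H) p u v :
  path (@adj H) x p -> link_edge x p u v -> adj u v.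
Proof.
move=> /(pathP x) path_p uv; have /andP[up vp] := link_edge_mem uv.
case/andP: uv => _ /eqP uv.
have ip : index u (x :: p) < size p by move: vp; rewrite -index_mem uv ltnS.
have := path_p _ ip; rewrite nth_index //.
by rewrite -[nth x p _]/(nth x (x :: p) _.+1) -uv nth_index.
Qed.

Lemma connecting_link (V : finType) (e : rel V) (c1 c2 : seq V) :
  {in c1 & c2, forall x y, connect e x y} -> c1 != [::] -> c2 != [::] ->
  #|[set x in c1] :&: [set x in c2]| <= 1 ->
  exists x p, [/\ x \in c1, last x p \in c2, path e x p & uniq (x :: p)] /\
    [/\ forall z, z \in x :: p -> z \in c1 -> z = x,
        forall z, z \in x :: p -> z \in c2 -> z = last x p &
        forall z, z \in c1 -> z \in c2 -> z = x /\ p = [::]].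
Proof.
move=> conn n1 n2 /card_le1_eqP share.
case: (pickP [pred z | (z \in c1) && (z \in c2)]) => [w /andP[w1 w2]|noshare].
  exists w, [::]; split; split=> // z; first by rewrite inE => /eqP.
    by rewrite inE => /eqP.
  by move=> z1 z2; split=> //; apply: share; rewrite !inE ?w1 ?w2 ?z1.
have [x x1] : exists x, x \in c1 by case: (c1) n1 => // x c _; exists x; rewrite mem_head.
have [y y2] : exists y, y \in c2 by case: (c2) n2 => // y c _; exists y; rewrite mem_head.
have /connectP[q0 q0path yq] := conn x y x1 y2.
case/shortenP: q0path yq => q qpath Uq _ yq; rewrite {}yq in y2.
have [x' [p [x'1 l2 pp Up ends]]] := shortest_link (A := mem c1) (B := mem c2) x1 y2 qpath Uq.
exists x', p; split; split=> // z.
- by move=> /ends[end1 _] /end1.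
- by move=> /ends[_ end2] /end2.
- by move=> z1 z2; have := noshare z; rewrite /= z1 z2.
Qed.

Theorem corollary7p8 (H : sgraph) (c1 c2 : seq H)
  (Hconn : connected_graph H)
  (Hc1 : graph_cycle c1) (Hodd1 : odd (size c1)) (Hlen1 : 5 <= size c1)
  (Hc2 : graph_cycle c2) (Hodd2 : odd (size c2)) (Hlen2 : 5 <= size c2)
  (Hshare : #|[set x in c1] :&: [set x in c2]| <= 1) :
  ~ contractible H.
Proof.
have /andP[_ C1] := Hc1; have /andP[_ C2] := Hc2.
have U1 : uniq c1 by case/andP: C1.
have U2 : uniq c2 by case/andP: C2.
have conn : {in c1 & c2, forall y z, connect (@adj H) y z}.
  by move=> y z _ _; apply: Hconn.2; rewrite inE.
have n1 : c1 != [::] by case: (c1) Hlen1.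
have n2 : c2 != [::] by case: (c2) Hlen2.
have [x [p [[xc1 lastc2 path_p Up] [link1 link2 share]]]] :=
  connecting_link conn n1 n2 Hshare.
have d_sym := dumbbell_sym c1 c2 x p.
have d_adj u v : dumbbell c1 c2 x p u v -> adj u v.
  case/or4P => [uv|uv|uv|vu].
  - exact: cyc_edge_adj C1 uv.
  - exact: cyc_edge_adj C2 uv.
  - exact: link_edge_adj path_p uv.
  - by rewrite adj_sym; apply: link_edge_adj path_p vu.
move=> /(_ _ (shadow_root d_sym d_adj)) contr.
have inj_root : injective (shadow_root d_sym d_adj) by move=> u v [].
have [C [rootC disjC connC adjC]] :=
  shadow_graph_bags (contr inj_root (shadow_graph_scheme d_sym d_adj)).
exact: (dumbbell_no_bags (p := p) U1 Hodd1 Hlen1 U2 Hodd2 Hlen2 xc1 lastc2 Up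
  link1 link2 share rootC disjC connC adjC).
Qed.
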